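(* For every $d \geq 2$, every chamber in the $k$-th Brillouin zone of $0 \in \mathbb{Z}^d$ has diameter at most $O\bigl(k^{(-1+1/2^{d-1})/d}\bigr)$ (as $k \to \infty$, with $d$ fixed). Specifically, for every integer $k \geq \nu_d (18 d\sqrt d)^d$, every chamber in the $k$-th Brillouin zone of $0 \in \mathbb{Z}^d$ has diameter at most $$18\, d\sqrt d \cdot \nu_d^{1/d} \cdot k^{(-1+1/2^{d-1})/d}.$$
   Context: $\nu_d$ is the $d$-dimensional volume of the unit ball in $\mathbb{R}^d$. For $a \in \mathbb{Z}^d \setminus \{0\}$, the bisector of $0$ and $a$ is the hyperplane $\{x \in \mathbb{R}^d : \|x\| = \|x-a\|\}$. The chambers of the arrangement of these bisectors are the closures of the connected components of the complement in $\mathbb{R}^d$ of the union of all bisectors. The $k$-th Brillouin zone of $0$ in $\mathbb{Z}^d$ is the set of $x \in \mathbb{R}^d$ such that $\|x-a\| < \|x\|$ for at most $k-1$ points $a \in \mathbb{Z}^d\setminus\{0\}$ and $\|x-b\| \leq \|x\|$ for at least $k-1$ points $b \in \mathbb{Z}^d \setminus\{0\}$; it is the union of those chambers whose interior points are separated from $0$ by exactly $k-1$ bisectors, and these are its chambers. *)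

(* Defs.v *)
From HB Require Import structures.
From mathcomp Require Import all_boot all_order all_algebra.
From mathcomp Require Import all_classical all_reals all_analysis.

Set Implicit Arguments.
Unset Strict Implicit.
Unset Printing Implicit Defensive.

Import Order.TTheory GRing.Theory Num.Theory.
Import numFieldNormedType.Exports.

Local Open Scope classical_set_scope.
Local Open Scope ring_scope.
Local Open Scope card_scope.

Section Euclidean.
Variable R : realType.

(* The norm that the library puts on 'rV[R]_d is the sup norm. It induces the
   Euclidean topology, so only the norm and the diameter are redefined. *)
Definition enorm (d : nat) (x : 'rV[R]_d) : R :=
  Num.sqrt (\sum_(i < d) x ord0 i ^+ 2).

Definition ediam (d : nat) (A : set 'rV[R]_d) : \bar R :=
  ereal_sup [set (enorm (p.1 - p.2))%:E | p in A `*` A].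

(* d-dimensional Lebesgue measure on the Borel sets of R^d (tuples carry the
   product sigma-algebra), with R^(n+1) identified with R * R^n. *)
Fixpoint volume (d : nat) : set (d.-tuple R) -> \bar R :=
  if d is n.+1 then
    fun A => (lebesgue_measure \x volume (d := n))%E
               [set p : R * n.-tuple R | A (cons_tuple p.1 p.2)]
  else fun A => \d_([tuple] : 0.-tuple R) A.

Definition unit_ball_volume (d : nat) : R :=
  fine (volume [set t : d.-tuple R | enorm (\row_i tnth t i) <= 1]).

End Euclidean.

Section Brillouin.
Variables (R : realType) (d : nat).

Definition lattice_pt (a : 'rV[int]_d) : 'rV[R]_d := map_mx intr a.

Definition bisector (a : 'rV[int]_d) : set 'rV[R]_d :=
  [set x | enorm x = enorm (x - lattice_pt a)].

Definition bisector_complement : set 'rV[R]_d :=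
  ~` \bigcup_(a in [set a | a != 0]) bisector a.

Definition is_chamber (C : set 'rV[R]_d) : Prop :=
  exists2 x, bisector_complement x &
    C = closure (connected_component bisector_complement x).

(* Zones are numbered from 1: because of the truncated predecessor, the value
   at k = 0 is a copy of the first zone. *)
Definition brillouin_zone (k : nat) : set 'rV[R]_d :=
  [set x |
     [set a | a != 0 /\ enorm (x - lattice_pt a) < enorm x] #<= `I_k.-1 /\
     `I_k.-1 #<= [set b | b != 0 /\ enorm (x - lattice_pt b) <= enorm x]].

Definition is_brillouin_chamber (k : nat) (C : set 'rV[R]_d) : Prop :=
  is_chamber C /\ C `<=` brillouin_zone k.

End Brillouin.

(* Main.v *)
Require Import Defs.
From HB Require Import structures.
From mathcomp Require Import all_boot all_order all_algebra.
From mathcomp Require Import all_classical all_reals all_analysis.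
From mathcomp Require Import measurable_realfun zify ring lra.

Set Implicit Arguments.
Unset Strict Implicit.
Unset Printing Implicit Defensive.

Import Order.TTheory GRing.Theory Num.Theory.
Import numFieldNormedType.Exports.

Local Open Scope classical_set_scope.
Local Open Scope ring_scope.

(** Two points [x], [y] of one chamber are never strictly separated by a
    bisector. The proof produces a lattice point whose bisector separates two
    points of the segment [x, y] as soon as [x] and [y] are too far apart.

    Let [z] be the midpoint of the segment, [r = |z|], and let [v] be the one
    of the half differences [x - z], [y - z] that satisfies [z.v >= 0]. The
    power [f_a(p) = |p - a|^2 - |p|^2] is affine in [p], its zero set is the
    bisector of [a], and [f_a(z + v) = f_a(z) - 2 a.v]. No bisector separates
    [z] from [z + v], so every lattice point [a] just outside the sphere of
    center [z] through the origin satisfies [2 a.v <= f_a(z)]; the aim is to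
    make [f_a(z)] small and [a.v] large.

    Pick a coordinate [i] in which [v] is largest, so that
    [|v_i| >= |v| / sqrt d]. Rounding [z_i + r] or [z_i - r], according to the
    sign of [v_i], towards [z_i] gives [a_i] with [|a_i - z_i|] in
    [(r - 1, r]]; what is left of the budget [r^2] is at most [2r]. Spending
    the budget greedily on the remaining coordinates takes its square root, up
    to a factor 2, at every step ([greedy_coordinates]), so that
    [0 < f_a(z) <= 4 r^(1/2^(d-1)) + d - 1]. All coordinates of [a - z] other
    than the [i]-th are of size [O(sqrt r)], hence
    [a.v >= |v| (r / sqrt d - O(sqrt r))] ([same_side_dist_le]). Together,
    [|v| = O(r^(-1 + 1/2^(d-1)))].

    To replace [r] by [k], count lattice points. All chamber points, and with
    them [z], have at least [k] lattice points, the origin included, no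
    farther away than the origin. The unit cubes around these points are
    disjoint and lie in the ball of radius [r + sqrt d / 2] around [z], so
    [k <= nu_d (r + sqrt d / 2)^d] ([zone_count_le]). The volume is given by
    iterated integrals of sections, so both ingredients, [size_le_volume] and
    [volume_ball], are proved by induction on the dimension. *)

(** * Volume of Euclidean balls *)

Lemma volumeS (R : realType) n (A : set (n.+1.-tuple R)) :
  volume A =
  (\int[lebesgue_measure]_x volume [set t : n.-tuple R | A (cons_tuple x t)])%E.
Proof.
rewrite /= /product_measure1; apply: eq_integral => x _ /=.
by congr (volume _); apply/seteqP; split => t; rewrite /xsection /= inE.
Qed.

(** The measure [A |-> r * lebesgue_measure (r^-1 A)] agrees with Lebesgue
    measure on intervals, hence everywhere. *)
Lemma ge0_integral_scale (R : realType) (r : R) (f : R -> \bar R) :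
  0 < r -> measurable_fun [set: R] f -> (forall x, (0 <= f x)%E) ->
  (\int[lebesgue_measure]_x f x =
   r%:E * \int[lebesgue_measure]_x f (r * x)%R)%E.
Proof.
move=> r0 mf f0.
pose phi : measurableTypeR R -> measurableTypeR R := fun x => r * x.
have mphi : measurable_fun setT phi by exact: measurable_funM.
pose r' : {nonneg R} := NngNum (ltW r0).
have [nu nuE] : exists nu : {measure set (measurableTypeR R) -> \bar R},
    nu = mscale r' (pushforward lebesgue_measure phi) :> (set _ -> _).
  by unshelve eexists (mscale r' (pushforward lebesgue_measure phi)).
have munu A : measurable A -> lebesgue_measure A = nu A.
  move=> mA; apply: lebesgue_measure_unique => // _ [[a b]] _ <-.
  rewrite nuE /mscale /=.
  have phiE : phi @^-1` `]a, b] = `](a / r), (b / r)]%classic.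
    apply/seteqP; split=> x; rewrite /phi /= !in_itv/=.
      by rewrite ltr_pdivrMr// ler_pdivlMr// mulrC.
    by rewrite ltr_pdivrMr// ler_pdivlMr// mulrC.
  have -> : pushforward lebesgue_measure phi `]a, b] =
            lebesgue_measure `](a / r), (b / r)] by rewrite -phiE.
  rewrite !lebesgue_measure_itv/= !lte_fin ltr_pM2r ?invr_gt0//.
  case: ifPn => _; last by rewrite mule0.
  rewrite -!EFinB -EFinM; congr EFin.
  by field; rewrite gt_eqF.
transitivity (\int[nu]_x f x)%E.
  by apply: eq_measure_integral => A mA _; exact: munu.
rewrite nuE ge0_integral_mscale//; congr (_ * _)%E.
by rewrite ge0_integral_pushforward.
Qed.

(** The parameter is the squared radius, and may be negative: this makes the
    sections of a ball balls again, without case distinction. *)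
Definition sqball (R : realType) n (E : R) : set (n.-tuple R) :=
  [set t | \sum_(i < n) tnth t i ^+ 2 <= E].
Arguments sqball {R} n E.

Lemma volume_sqballS (R : realType) n (E : R) :
  volume (sqball n.+1 E) =
  (\int[lebesgue_measure]_x volume (sqball n (E - x ^+ 2)))%E.
Proof.
rewrite volumeS; apply: eq_integral => x _; congr (volume _).
apply/funext => t; rewrite /sqball /= big_ord_recl lerBrDl.
rewrite (tnth_nth 0)/=; congr (is_true (_ + _ <= _)).
by apply: eq_bigr => i _; rewrite !(tnth_nth 0).
Qed.

(** By induction the volume of the ball of squared radius [E] is the integral
    of [c (E - x^2)^(n/2)], and the substitution [x = sqrt E * u] pulls out the
    factor [sqrt E ^ n.+1]. The explicit form of the integrand provides its
    measurability. *)
Lemma volume_sqball (R : realType) n :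
  exists2 c : R, 0 <= c &
    forall E, volume (sqball n E) =
      (if 0 <= E then c * Num.sqrt E ^+ n else 0)%:E.
Proof.
elim: n => [|n [c c0 IH]].
  exists 1 => // E; rewrite /= diracE expr0 mulr1.
  have -> : ([tuple] \in sqball 0 E) = (0 <= E).
    by apply/idP/idP; rewrite inE /sqball /= big_ord0.
  by case: ifP.
pose h (E x : R) : R :=
  if 0 <= E - x ^+ 2 then c * Num.sqrt (E - x ^+ 2) ^+ n else 0.
have h0 E x : 0 <= h E x.
  by rewrite /h; case: ifP => // _; rewrite mulr_ge0 ?exprn_ge0 ?sqrtr_ge0.
have mh E : measurable_fun [set: R] (h E).
  have mE : measurable_fun [set: R] (fun x : R => E - x ^+ 2).
    by apply: measurable_funB => //; exact: measurable_funX.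
  apply: measurable_fun_ifT => //; first exact: measurable_fun_ler.
  apply: measurable_funM => //; apply: measurable_funX.
  apply: (measurableT_comp _ mE).
  by apply: continuous_measurable_fun; exact: sqrt_continuous.
have volE E : volume (sqball n.+1 E) =
    (\int[lebesgue_measure]_x (h E x)%:E)%E.
  by rewrite volume_sqballS; apply: eq_integral => x _; rewrite IH.
have hscale E x : 0 < E -> h E (Num.sqrt E * x) = Num.sqrt E ^+ n * h 1 x.
  move=> E0; rewrite /h; have -> : E - (Num.sqrt E * x) ^+ 2 = E * (1 - x ^+ 2).
    by rewrite exprMn sqr_sqrtr ?ltW//; ring.
  rewrite pmulr_rge0//; case: ifP => _; last by rewrite mulr0.
  by rewrite sqrtrM ?ltW// exprMn; ring.
have int_fin : (\int[lebesgue_measure]_x (h 1 x)%:E < +oo)%E.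
  have h1le x : h 1 x <= c * \1_(`[-1, 1]%classic) x.
    rewrite /h indicE; case: ifPn => [x1|_]; last by rewrite mulr_ge0.
    rewrite mem_set ?mulr1; last first.
      rewrite /= in_itv /= -ler_norml -[leRHS]sqrtr1 -sqrtr_sqr ler_sqrt//.
      by rewrite -subr_ge0.
    rewrite -[leRHS]mulr1 ler_wpM2l// exprn_ile1// ?sqrtr_ge0//.
    by rewrite -[leRHS]sqrtr1 ler_sqrt// lerBlDl lerDr sqr_ge0.
  apply: (@le_lt_trans _ _
      (\int[lebesgue_measure]_x (c%:E * (\1_(`[-1, 1]%classic) x)%:E))%E).
    apply: ge0_le_integral => //.
    - by move=> x _; rewrite lee_fin.
    - by apply/measurable_EFinP; exact: mh.
    - by apply: measurable_funeM; exact/measurable_EFinP.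
    - by move=> x _; rewrite -EFinM lee_fin.
  rewrite ge0_integralZl_EFin//; last exact/measurable_EFinP.
  rewrite integral_indic// setIT/= lebesgue_measure_itv/= lte_fin ifT ?ltrN10//.
  by rewrite -EFinB -EFinM ltry.
have int_ge0 : (0 <= \int[lebesgue_measure]_x (h 1 x)%:E)%E.
  by apply: integral_ge0 => x _; rewrite lee_fin.
exists (fine (\int[lebesgue_measure]_x (h 1 x)%:E)); first exact: fine_ge0.
move=> E; rewrite volE.
case: (ltrgtP 0 E) => [E0|E0|<-].
- rewrite (ge0_integral_scale (r := Num.sqrt E)) ?sqrtr_gt0//; last 2 first.
    by apply/measurable_EFinP; exact: mh.
    by move=> x; rewrite lee_fin.
  under eq_integral do rewrite hscale// EFinM.
  rewrite ge0_integralZl_EFin ?exprn_ge0 ?sqrtr_ge0//; last 2 first.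
    by move=> x _; rewrite lee_fin.
    by apply/measurable_EFinP; exact: mh.
  rewrite -{1}[X in (_ * (_ * X))%E]fineK ?ge0_fin_numE//.
  by rewrite -!EFinM; congr EFin; rewrite exprS; ring.
- apply: integral0_eq => x _; rewrite /h ifF//.
  by apply/negbTE; rewrite -ltNge; have := sqr_ge0 x; lra.
- rewrite sqrtr0 exprS mul0r mulr0.
  (* A ball of radius 0 is a point: the integrand vanishes outside {0}. *)
  rewrite -[RHS](integral_set1 (fun x => (h 0 x)%:E) 0) [RHS]integral_mkcond.
  apply: eq_integral => x _; rewrite patchE; case: ifPn => // /negP x0.
  rewrite /h sub0r oppr_ge0 ifF//; apply/negbTE; rewrite -ltNge.
  by rewrite exprn_even_gt0//=; apply/eqP => xE; apply: x0; rewrite xE inE.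
Qed.

(** * Counting lattice points by volume *)

(** The integral of a nonnegative function is a supremum over the simple
    functions below it, hence monotone among all nonnegative functions. This
    form applies to the volumes of the sections of an arbitrary set. *)
Lemma ge0_le_integral_nonmeasurable d (T : measurableType d) (R : realType)
    (mu : {measure set T -> \bar R}) (f g : T -> \bar R) :
  (forall x, (0 <= f x)%E) -> (forall x, (f x <= g x)%E) ->
  (\int[mu]_x f x <= \int[mu]_x g x)%E.
Proof.
move=> f0 fg; rewrite !ge0_integralTE//; last first.
  by move=> x; exact: le_trans (f0 x) (fg x).
apply: le_ereal_sup => _ [h hf <-]; exists h => // x.
exact: le_trans (hf x) (fg x).
Qed.

Lemma volume_ge0 (R : realType) n (A : set (n.-tuple R)) : (0 <= volume A)%E.
Proof.
elim: n A => [|n IH] A; first exact: measure_ge0.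
by rewrite volumeS; apply: integral_ge0 => x _; exact: IH.
Qed.

(** A set that contains the disjoint open unit cubes centered at [a - z], for
    [a] in [s], has volume at least [size s]. Slicing along the first
    coordinate, the section at [x] contains the cubes of those [a] whose first
    coordinate [m] satisfies [|x - (m - z_0)| < 1/2]; there is at most one such
    [m], and each [a] contributes to the slices over an interval of
    length 1. *)
Lemma size_le_volume (R : realType) n (s : seq (n.-tuple int)) (z : n.-tuple R)
    (A : set (n.-tuple R)) :
  uniq s ->
  (forall a, a \in s -> forall t : n.-tuple R,
     (forall i, `|tnth t i - ((tnth a i)%:~R - tnth z i)| < 2^-1) -> A t) ->
  ((size s)%:R%:E <= volume A)%E.
Proof.
elim: n s z A => [|n IH] s z A us sA.
  case: s us sA => [|a s] us sA; first exact: volume_ge0.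
  have -> : s = [::].
    case: s us {sA} => // b s.
    by rewrite [a]tuple0 [b]tuple0 cons_uniq in_cons eqxx.
  rewrite /= diracE mem_set//; apply: (sA a); first exact: mem_head.
  by case.
pose w : n.-tuple R := [tuple of behead z].
pose tl (a : n.+1.-tuple int) : n.-tuple int := [tuple of behead a].
pose I (m : int) : set R :=
  `](m%:~R - thead z - 2^-1), (m%:~R - thead z + 2^-1)[%classic.
have mI m : measurable (I m : set (measurableTypeR R)) by exact: measurable_itv.
have muI m : lebesgue_measure (I m) = 1%E.
  rewrite /I lebesgue_measure_itv/= lte_fin ifT.
    by rewrite -EFinB; congr EFin; field.
  by rewrite ltrD2l; lra.
have I_inj x m m' : I m x -> I m' x -> m = m'.
  rewrite /I /= !in_itv/= => /andP[h1 h2] /andP[h3 h4].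
  have : (m - m')%:~R < (1 : R) by rewrite intrB; lra.
  have : (m' - m)%:~R < (1 : R) by rewrite intrB; lra.
  rewrite -[1 in X in X -> _]/(1%:~R) -[1 in X in _ -> X -> _]/(1%:~R) !ltr_int.
  lia.
have -> : ((size s)%:R%:E =
    \int[lebesgue_measure]_x \sum_(a <- s) (\1_(I (thead a)) x)%:E :> \bar R)%E.
  rewrite ge0_integral_sum//; last first.
    by move=> a; apply/measurable_EFinP; exact: measurable_indic.
  rewrite (eq_bigr (fun=> 1%E)) => [|a _]; last first.
    by rewrite integral_indic// setIT -(muI (thead a)).
  by rewrite sumEFin big_const_seq count_predT iter_addr_0.
rewrite volumeS; apply: ge0_le_integral_nonmeasurable => [x|x].
  by apply: sume_ge0 => a _; rewrite lee_fin.
have [/hasP[b bs /asboolP bx]|/hasPn nI] :=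
  boolP (has (fun a => `[< I (thead a) x >]) s); last first.
  rewrite big_seq big1 ?volume_ge0// => a /nI /asboolP aI.
  by rewrite indicE memNset.
pose s' := [seq a <- s | thead a == thead b].
have -> : (\sum_(a <- s) (\1_(I (thead a)) x)%:E = (size s')%:R%:E :> \bar R)%E.
  transitivity (\sum_(a <- s) ((thead a == thead b)%:R : R)%:E)%E.
    apply: eq_bigr => a _; rewrite indicE; congr (_%:R%:E); congr nat_of_bool.
    apply/idP/eqP => [|->]; last by rewrite inE.
    by rewrite inE => /I_inj; apply.
  rewrite sumEFin -natr_sum /s' size_filter -sum1_count [in RHS]big_mkcond/=.
  by congr (_%:R%:E); apply: eq_bigr => a _; case: eqP.
rewrite -(size_map tl s'); apply: (IH _ w).
  rewrite map_inj_in_uniq ?filter_uniq// => a a'.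
  rewrite !mem_filter => /andP[/eqP ab _] /andP[/eqP a'b _] aa'.
  move/(congr1 val): aa' => /= aa'.
  by apply: val_inj; rewrite (tuple_eta a) (tuple_eta a') /= ab a'b aa'.
move=> _ /mapP[a + ->] t ta; rewrite mem_filter => /andP[/eqP ab as_] /=.
apply: (sA a as_) => i; have [j ->|->] := unliftP ord0 i.
  by have := ta j; rewrite !(tnth_nth 0) /= !nth_behead.
rewrite tnth0 -/(thead a) -/(thead z) ab.
move: bx; rewrite /I /= in_itv/= ltr_norml => /andP[h1 h2].
by apply/andP; split; lra.
Qed.

(** Cauchy-Schwarz, from [0 <= \sum_i (B x_i - C y_i)^2 = B (A B - C^2)]. *)
Lemma sum_mul_sqr_le (R : realFieldType) (I : finType) (x y : I -> R) :
  (\sum_i x i * y i) ^+ 2 <= (\sum_i x i ^+ 2) * (\sum_i y i ^+ 2).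
Proof.
set C := \sum_i _; set A := \sum_i _; set B := \sum_i _.
have B0 : 0 <= B by apply: sumr_ge0 => i _; exact: sqr_ge0.
have : 0 <= B * (A * B - C ^+ 2).
  have -> : B * (A * B - C ^+ 2) = \sum_i (B * x i - C * y i) ^+ 2.
    transitivity (\sum_i (B ^+ 2 * x i ^+ 2 - 2 * B * C * (x i * y i)
        + C ^+ 2 * y i ^+ 2)); last by apply: eq_bigr => i _; ring.
    by rewrite big_split sumrB -!mulr_sumr -/A -/B -/C /=; ring.
  by apply: sumr_ge0 => i _; exact: sqr_ge0.
move: B0; rewrite le_eqVlt => /predU1P[B0 _|B0].
  have y0 i : y i = 0.
    apply/eqP; rewrite -sqrf_eq0; move/esym/psumr_eq0P : B0 => -> //.
    by move=> j _; exact: sqr_ge0.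
  have -> : C = 0 by rewrite /C big1// => i _; rewrite y0 mulr0.
  by rewrite expr0n mulr_ge0 ?sumr_ge0// => i _; exact: sqr_ge0.
by rewrite pmulr_rge0// subr_ge0.
Qed.

Lemma sum_mul_le_sqrt (R : rcfType) (I : finType) (x y : I -> R) :
  `|\sum_i x i * y i| <=
  Num.sqrt (\sum_i x i ^+ 2) * Num.sqrt (\sum_i y i ^+ 2).
Proof.
rewrite -sqrtrM; last by rewrite sumr_ge0// => i _; exact: sqr_ge0.
by rewrite -sqrtr_sqr; apply: ler_wsqrtr; exact: sum_mul_sqr_le.
Qed.

Lemma sqrt_sum_sqrD_le (R : rcfType) (I : finType) (x y : I -> R) :
  Num.sqrt (\sum_i (x i + y i) ^+ 2) <=
  Num.sqrt (\sum_i x i ^+ 2) + Num.sqrt (\sum_i y i ^+ 2).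
Proof.
have sum_sqr_ge0 (w : I -> R) : 0 <= \sum_i w i ^+ 2.
  by apply: sumr_ge0 => i _; exact: sqr_ge0.
rewrite -(@ler_pXn2r _ 2) ?nnegrE ?addr_ge0 ?sqrtr_ge0//.
rewrite sqrrD !sqr_sqrtr//.
have -> : \sum_i (x i + y i) ^+ 2 =
    \sum_i x i ^+ 2 + (\sum_i x i * y i) *+ 2 + \sum_i y i ^+ 2.
  by rewrite -sumrMnl -!big_split/=; apply: eq_bigr => i _; rewrite sqrrD.
rewrite lerD2r lerD2l lerMn2r/=.
exact: le_trans (ler_norm _) (sum_mul_le_sqrt x y).
Qed.

Lemma enorm_ge0 (R : realType) d (x : 'rV[R]_d) : 0 <= enorm x.
Proof. exact: sqrtr_ge0. Qed.

Lemma sqr_enorm (R : realType) d (x : 'rV[R]_d) :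
  enorm x ^+ 2 = \sum_i x ord0 i ^+ 2.
Proof. by rewrite sqr_sqrtr// sumr_ge0// => i _; exact: sqr_ge0. Qed.

Lemma volume_ball (R : realType) d (r : R) : 0 <= r ->
  volume (sqball d (r ^+ 2)) = (unit_ball_volume R d * r ^+ d)%:E.
Proof.
move=> r0; have [c c0 volE] := volume_sqball R d.
have -> : unit_ball_volume R d = c.
  rewrite /unit_ball_volume; set B := [set t | _].
  have -> : B = sqball d 1.
    apply/funext => t; rewrite /B /sqball /enorm /=.
    rewrite -[in LHS]sqrtr1 ler_psqrt ?nnegrE//; last first.
      by rewrite sumr_ge0// => i _; exact: sqr_ge0.
    by congr (is_true (_ <= _)); apply: eq_bigr => i _; rewrite mxE.
  by rewrite volE ler01 sqrtr1 expr1n mulr1.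
by rewrite volE sqr_ge0 sqrtr_sqr ger0_norm.
Qed.

(** The ball is enlarged by half the diagonal of the unit cube, so that it
    contains the unit cubes around the lattice points. *)
Lemma lattice_count_le (R : realType) d (z : 'rV[R]_d) (r : R)
    (s : seq 'rV[int]_d) :
  0 <= r -> uniq s -> (forall a, a \in s -> enorm (z - lattice_pt R a) <= r) ->
  (size s)%:R <= unit_ball_volume R d * (r + Num.sqrt d%:R / 2) ^+ d.
Proof.
move=> r0 us sr; rewrite -lee_fin -volume_ball ?addr_ge0 ?divr_ge0 ?sqrtr_ge0//.
pose tup (a : 'rV[int]_d) : d.-tuple int := [tuple a ord0 i | i < d].
rewrite -(size_map tup s).
apply: (@size_le_volume _ _ _ [tuple z ord0 i | i < d]).
  rewrite map_inj_uniq// => a b /(congr1 (fun t => tnth t)) ab.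
  by apply/rowP => i; have := congr1 (@^~ i) ab; rewrite !tnth_mktuple.
move=> _ /mapP[a /sr ar ->] t ta; rewrite /sqball /=.
set u := fun i => tnth t i - ((a ord0 i)%:~R - z ord0 i).
have -> : \sum_i tnth t i ^+ 2 =
    Num.sqrt (\sum_i (u i + ((a ord0 i)%:~R - z ord0 i)) ^+ 2) ^+ 2.
  rewrite sqr_sqrtr; last by rewrite sumr_ge0// => i _; exact: sqr_ge0.
  by apply: eq_bigr => i _; rewrite /u subrK.
rewrite ler_pXn2r ?nnegrE ?addr_ge0 ?divr_ge0 ?sqrtr_ge0//.
apply: le_trans (sqrt_sum_sqrD_le _ _) _; rewrite addrC lerD//.
  apply: le_trans ar; rewrite ler_wsqrtr// ler_sum// => i _.
  by rewrite !mxE -sqrrN opprB.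
have -> : Num.sqrt d%:R / 2 = Num.sqrt (d%:R * 2^-1 ^+ 2) :> R.
  by rewrite sqrtrM ?ler0n// sqrtr_sqr ger0_norm// invr_ge0.
rewrite ler_wsqrtr// mulr_natl -[d in leRHS]card_ord -sumr_const.
rewrite ler_sum// => i _.
have := ta i; rewrite !tnth_mktuple -/(u i) => /ltW ui.
by rewrite -real_normK ?num_real// ler_pXn2r ?nnegrE ?invr_ge0.
Qed.

(** The ball of radius [sqrt d / 2] contains the unit cube around 0. *)
Lemma unit_ball_volume_ge (R : realType) d :
  1 <= unit_ball_volume R d * (Num.sqrt d%:R / 2) ^+ d.
Proof.
have := @lattice_count_le R d 0 0 [:: 0] (lexx _) isT.
rewrite add0r; apply => a.
rewrite inE => /eqP ->; rewrite sub0r /enorm big1 ?sqrtr0// => i _.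
by rewrite !mxE oppr0 expr0n.
Qed.

Lemma card_le_seq (T : choiceType) n (B : set T) : (`I_n #<= B)%card ->
  exists s : seq T, [/\ uniq s, size s = n & forall a, a \in s -> B a].
Proof.
move=> /card_leP[g].
pose f (i : 'I_n) : T :=
  \val (g (SigSub (mem_set (ltn_ord i) : val i \in `I_n))).
exists [seq f i | i <- enum 'I_n]; rewrite size_map size_enum_ord; split=> //.
  rewrite map_inj_uniq ?enum_uniq// => i j.
  move=> /val_inj /(inj (mem_set I) (mem_set I)).
  by move=> /(congr1 val) ij; apply: val_inj.
by move=> _ /mapP[i _ ->]; exact: set_valP.
Qed.

(** The origin is counted in addition to the [k.-1] points [b]. *)
Lemma zone_count_le (R : realType) d k (z : 'rV[R]_d) : (0 < k)%N ->
  (`I_k.-1 #<=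
     [set b | b != 0%R /\ enorm (z - lattice_pt R b) <= enorm z])%card ->
  k%:R <= unit_ball_volume R d * (enorm z + Num.sqrt d%:R / 2) ^+ d.
Proof.
move=> k0 /card_le_seq[s [us ss sB]].
have := @lattice_count_le R d z (enorm z) (0 :: s).
rewrite /= ss prednK//; apply; first exact: enorm_ge0.
  by rewrite us andbT; apply/negP => /sB[/eqP].
move=> a; rewrite inE => /predU1P[->|/sB[]//].
have -> : lattice_pt R (0 : 'rV[int]_d) = 0 by apply/rowP => i; rewrite !mxE.
by rewrite subr0.
Qed.

(** * Greedy choice of a lattice point near a sphere *)

Lemma int_translate_near (R : realType) (x t : R) :
  exists a : int, t - 1 < a%:~R - x <= t.
Proof.
exists (Num.floor (x + t)); have := floor_itv (x + t).
by rewrite intrD => /andP[h1 h2]; apply/andP; split; lra.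
Qed.

(** Spend the budget [E] on the coordinates one after the other: [a_i] is
    chosen with [a_i - x_i] in [(sqrt E - 1, sqrt E]], which leaves a budget of
    at most [2 sqrt E]; the last coordinate overshoots, which makes the
    difference positive. The bound [4 Q ^ (2 ^ m.+1)] is stable under
    [E |-> 2 sqrt E]. When [E < 1] the step may overspend, but by less than 1;
    [c] records the accumulated deficit. *)
Lemma greedy_coordinates (R : realType) m (x : 'I_m.+1 -> R) (Q c E : R) :
  1 <= Q -> 0 <= c -> - c <= E <= 4 * Q ^+ (2 ^ m.+1) ->
  exists a : 'I_m.+1 -> int,
    0 < \sum_i ((a i)%:~R - x i) ^+ 2 - E <= 4 * Q + 1 + c + m%:R.
Proof.
move=> Q1; elim: m x c E => [|m IH] x c E c0 /andP[cE EQ].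
  have [a /andP[ta at1]] := int_translate_near (x ord0) (Num.sqrt E + 1).
  exists (fun=> a); rewrite big_ord1 addr0.
  have sqrtE0 := sqrtr_ge0 E.
  have tQ : Num.sqrt E <= 2 * Q.
    rewrite -[leRHS]ger0_norm -?sqrtr_sqr; last by lra.
    by apply: ler_wsqrtr; move: EQ; rewrite expn1 exprMn; lra.
  have tE : E <= Num.sqrt E ^+ 2 <= E + c.
    have [E0|E0] := leP 0 E; first by rewrite sqr_sqrtr//; lra.
    by rewrite ltr0_sqrtr// expr0n/=; lra.
  by apply/andP; split; nra.
have [a /andP[ta at1]] := int_translate_near (x ord0) (Num.sqrt E).
have sqrtE0 := sqrtr_ge0 E.
have tQ : Num.sqrt E <= 2 * Q ^+ (2 ^ m.+1).
  have Q0 : 0 <= Q ^+ (2 ^ m.+1) by rewrite exprn_ge0//; lra.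
  rewrite -[leRHS]ger0_norm -?sqrtr_sqr; last by lra.
  apply: ler_wsqrtr; move: EQ; rewrite exprMn -exprM -expnSr; lra.
set s := a%:~R - x ord0 in ta at1.
have [sE Es] : - (c + 1) <= E - s ^+ 2 /\ E - s ^+ 2 <= 2 * Num.sqrt E.
  have [t1|t1] := leP 1 (Num.sqrt E).
    have E0 : 0 < E by rewrite -sqrtr_gt0; lra.
    have := sqr_sqrtr (ltW E0) => EE; split; nra.
  have : E <= Num.sqrt E ^+ 2.
    have [E0|E0] := leP 0 E; first by rewrite sqr_sqrtr//; lra.
    by rewrite ltr0_sqrtr// expr0n/=; lra.
  by move=> ?; split; nra.
have [||b /andP[b0 b1]] := IH (fun j => x (lift ord0 j)) (c + 1) (E - s ^+ 2).
- by lra.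
- by apply/andP; split=> //; lra.
exists (fun i => if unlift ord0 i is Some j then b j else a).
rewrite big_ord_recl unlift_none.
under eq_bigr do rewrite liftK.
rewrite -/s [in leRHS]mulrSr; apply/andP; split; lra.
Qed.

(** The coordinate [i] is chosen first and receives almost the full radius,
    in the direction of the sign of [v]; the budget that is left, at most
    [2 * r], bounds the displacement in the other coordinates. *)
Lemma lattice_pt_outside_sphere (R : realType) m (z : 'I_m.+2 -> R)
    (r Q v : R) i :
  1 <= Q -> 1 <= r -> r <= Q ^+ (2 ^ m.+1) ->
  exists a : 'I_m.+2 -> int,
  [/\ 0 < \sum_j ((a j)%:~R - z j) ^+ 2 - r ^+ 2 <= 4 * Q + 1 + m%:R,
      `|v| * (r - 1) <= ((a i)%:~R - z i) * v &
      \sum_(j < m.+1) ((a (lift i j))%:~R - z (lift i j)) ^+ 2 <=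
    2 * r + (4 * Q + 1 + m%:R)].
Proof.
move=> Q1 r1 rQ.
have [a0 [a0r a0v]] : exists a0 : int,
    r - 1 <= `|a0%:~R - z i| <= r /\ `|v| * (r - 1) <= (a0%:~R - z i) * v.
  have [v0|v0] := leP 0 v.
    have [a0 /andP[h1 h2]] := int_translate_near (z i) r; exists a0.
    rewrite ger0_norm; last by lra.
    by rewrite (ger0_norm v0); split; [apply/andP; split; lra|nra].
  have [a0 /andP[h1 h2]] := int_translate_near (- z i) r; exists (- a0).
  rewrite intrN; rewrite ler0_norm; last by lra.
  by rewrite (ltr0_norm v0); split; [apply/andP; split; lra|nra].
set s := a0%:~R - z i in a0r a0v.
have [E0 E1] : 0 <= r ^+ 2 - s ^+ 2 /\ r ^+ 2 - s ^+ 2 <= 2 * r.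
  rewrite -(real_normK (num_real s)); have := normr_ge0 s.
  by move: a0r => /andP[h1 h2] ?; split; nra.
have [|b /andP[b0 b1]] :=
    greedy_coordinates (fun j => z (lift i j))
      (E := r ^+ 2 - s ^+ 2) Q1 (lexx 0).
  by rewrite oppr0 E0/=; lra.
exists (fun j => if unlift i j is Some j' then b j' else a0).
rewrite (bigD1_ord i)//= unlift_none -/s.
have -> : \sum_(j < m.+1)
      ((if unlift i (lift i j) is Some j' then b j' else a0)%:~R
       - z (lift i j)) ^+ 2 =
    \sum_(j < m.+1) ((b j)%:~R - z (lift i j)) ^+ 2.
  by apply: eq_bigr => j _; rewrite liftK.
by split=> //; [apply/andP; split|]; lra.
Qed.

(** * Sides of the bisectors *)

(** The power of [x]: [|x - a|^2 - |x|^2], expanded so that it is visibly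
    affine in [x]. *)
Definition bisector_form (R : realType) d (a : 'rV[int]_d) (x : 'rV[R]_d) : R :=
  \sum_i (a ord0 i)%:~R * ((a ord0 i)%:~R - 2 * x ord0 i).

Lemma bisector_formE (R : realType) d (a : 'rV[int]_d) (x : 'rV[R]_d) :
  bisector_form a x = enorm (x - lattice_pt R a) ^+ 2 - enorm x ^+ 2.
Proof.
rewrite !sqr_enorm -sumrB; apply: eq_bigr => i _; rewrite !mxE; ring.
Qed.

Lemma bisector_form_le0 (R : realType) d (a : 'rV[int]_d) (x : 'rV[R]_d) :
  (bisector_form a x <= 0) = (enorm (x - lattice_pt R a) <= enorm x).
Proof. by rewrite bisector_formE subr_le0 ler_pXn2r ?nnegrE ?enorm_ge0. Qed.

Lemma bisector_form_eq0 (R : realType) d (a : 'rV[int]_d) (x : 'rV[R]_d) :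
  bisector_form a x = 0 -> bisector a x.
Proof.
rewrite bisector_formE => /eqP; rewrite subr_eq0 eqrXn2 ?enorm_ge0// => /eqP.
by rewrite /bisector /= => ->.
Qed.

Lemma bisector_formD (R : realType) d (a : 'rV[int]_d) (x v : 'rV[R]_d) :
  bisector_form a (x + v) =
  bisector_form a x - 2 * \sum_i (a ord0 i)%:~R * v ord0 i.
Proof.
rewrite /bisector_form mulr_sumr -sumrB; apply: eq_bigr => i _.
by rewrite !mxE; ring.
Qed.

Lemma bisector_form_continuous (R : realType) d (a : 'rV[int]_d) :
  continuous (@bisector_form R d a).
Proof.
apply: (@continuous_big _ _ +%R 0 xpredT (@add_continuous _) _ _
  (fun i (x : 'rV[R]_d) => (a ord0 i)%:~R * ((a ord0 i)%:~R - 2 * x ord0 i))).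
move=> i _ x; apply: (@continuous_comp _ _ _ (fun x : 'rV[R]_d => x ord0 i)
  (fun t : R => (a ord0 i)%:~R * ((a ord0 i)%:~R - 2 * t))).
  exact: coord_continuous.
apply: continuousM; first exact: cst_continuous.
apply: continuousB; first exact: cst_continuous.
by apply: continuousM; [exact: cst_continuous|exact: cvg_id].
Qed.

(** A chamber is the closure of a connected set on which [bisector_form a]
    does not vanish; so the form has constant sign on that set, and weakly on
    the closure. *)
Lemma chamber_one_side (R : realType) d (C : set 'rV[R]_d) :
  is_chamber C -> exists2 x0, C x0 &
    forall a, a != 0 -> bisector_form a x0 != 0 /\
      forall x, C x -> 0 <= bisector_form a x0 * bisector_form a x.
Proof.
move=> [x0 Ux0 CE].
have Kx0 := connected_component_refl Ux0.
exists x0; first by rewrite CE; exact: subset_closure.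
move=> a a0.
have fne0 (x : 'rV[R]_d) : bisector_complement x -> bisector_form a x != 0.
  by move=> Ux; apply/eqP => /bisector_form_eq0 ax; apply: Ux; exists a.
split; first exact: fne0.
set S := [set x | 0 <= bisector_form a x0 * bisector_form a x].
suff : C `<=` S by [].
have cg : continuous (fun x => bisector_form a x0 * bisector_form a x).
  move=> x; apply: (@continuous_comp _ _ _ (@bisector_form R d a)
    ( *%R (bisector_form a x0))).
    exact: bisector_form_continuous.
  by apply: continuousM; [exact: cst_continuous|exact: cvg_id].
have closedS : closed S.
  apply: (@closed_comp _ _ _ [set y : R | 0 <= y]) => [x _|]; first exact: cg.
  exact: closed_ge.
rewrite CE; move/closure_id : closedS => ->; apply: closure_subset => x Kx.
rewrite /S /=.
rewrite leNgt; apply/negP => fx.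
set K := connected_component _ _ in Kx Kx0 *.
have itv : is_interval (bisector_form a @` K).
  apply/connected_intervalP/connected_continuous_connected.
    exact: component_connected.
  exact/continuous_subspaceT/bisector_form_continuous.
have im y : K y -> (bisector_form a @` K) (bisector_form a y).
  by move=> Ky; exists y.
have [y Ky y0] : (bisector_form a @` K) 0.
  case: (ltrgtP 0 (bisector_form a x0)) => [f0|f0|f0].
  - by apply: (itv _ _ (im _ Kx) (im _ Kx0)); apply/andP; split; nra.
  - by apply: (itv _ _ (im _ Kx0) (im _ Kx)); apply/andP; split; nra.
  - by rewrite -f0 mul0r ltxx in fx.
by have := fne0 y (connected_component_sub Ky); rewrite y0 eqxx.
Qed.

(** * Distance of two points not separated by a bisector *)

Lemma exists_large_coordinate (R : realType) d (v : 'rV[R]_d.+1) :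
  exists i, enorm v <= Num.sqrt d.+1%:R * `|v ord0 i|.
Proof.
have [i _ imax] := @arg_maxP _ _ _ (@ord0 d) xpredT (fun i => `|v ord0 i|) isT.
exists i; rewrite -sqrtr_sqr -sqrtrM ?ler0n//; apply: ler_wsqrtr.
have -> : d.+1%:R * v ord0 i ^+ 2 = \sum_(j < d.+1) v ord0 i ^+ 2.
  by rewrite sumr_const card_ord mulr_natl.
apply: ler_sum => j _.
rewrite -real_normK ?num_real// -(real_normK (num_real (v ord0 i))).
by rewrite ler_pXn2r ?nnegrE//; exact: imax.
Qed.

(** Apply the hypothesis on sides to the point [a] of
    [lattice_pt_outside_sphere]: it gives [2 a.v <= f_a(z) <= F]. In
    [a.v = z.v + (a - z).v] the first term is nonnegative, the [i]-th term of
    the second is at least [|v_i| (|z| - 1)], and Cauchy-Schwarz bounds the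
    others. *)
Lemma same_side_dist_le (R : realType) m (z v : 'rV[R]_m.+2) (Q F : R) :
  F = 4 * Q + 1 + m%:R ->
  1 <= Q -> 1 <= enorm z -> enorm z <= Q ^+ (2 ^ m.+1) ->
  0 <= \sum_i z ord0 i * v ord0 i ->
  (forall a, a != 0 -> 0 < bisector_form a z -> 0 <= bisector_form a (z + v)) ->
  2 * enorm v * ((enorm z - 1) / Num.sqrt m.+2%:R - Num.sqrt (2 * enorm z + F))
    <= F.
Proof.
move=> FE Q1 r1 rQ zv sides.
have [i vi] := exists_large_coordinate v.
have [a [/andP[f0 fF] avi rest]] :=
  lattice_pt_outside_sphere (fun j => z ord0 j) (v ord0 i) i Q1 r1 rQ.
rewrite -FE in fF rest.
pose b : 'rV[int]_m.+2 := \row_j a j.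
have fE : bisector_form b z = \sum_j ((a j)%:~R - z ord0 j) ^+ 2 - enorm z ^+ 2.
  rewrite bisector_formE sqr_enorm; congr (_ - _).
  by apply: eq_bigr => j _; rewrite !mxE -sqrrN opprB.
have b0 : b != 0.
  apply/eqP => b0; move: f0; rewrite -fE b0 /bisector_form big1 ?ltxx// => j _.
  by rewrite mxE mul0r.
rewrite -fE in f0 fF.
have := sides b b0 f0; rewrite bisector_formD.
have -> : \sum_j (b ord0 j)%:~R * v ord0 j =
    \sum_j z ord0 j * v ord0 j + \sum_j ((a j)%:~R - z ord0 j) * v ord0 j.
  by rewrite -big_split/=; apply: eq_bigr => j _; rewrite mxE; ring.
rewrite [X in _ - 2 * (_ + X)](bigD1_ord i)//=.
set T := \sum_(j < m.+1) _ * _; set Z := \sum_i _ in zv *.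
have Tle : `|T| <= Num.sqrt (2 * enorm z + F) * enorm v.
  apply: le_trans (sum_mul_le_sqrt _ _) _.
  apply: ler_pM _ _ (ler_wsqrtr rest) _; rewrite ?sqrtr_ge0//.
  by apply: ler_wsqrtr; rewrite [leRHS](bigD1_ord i)//= lerDr sqr_ge0.
move: Tle; rewrite ler_norml => /andP[Tge _] side.
set s := Num.sqrt (2 * enorm z + F) in Tge *.
have vr : enorm v * ((enorm z - 1) / Num.sqrt m.+2%:R) <=
    `|v ord0 i| * (enorm z - 1).
  have D0 : 0 < Num.sqrt m.+2%:R :> R by rewrite sqrtr_gt0.
  by rewrite mulrA ler_pdivrMr// mulrAC ler_wpM2r ?subr_ge0// mulrC.
nra.
Qed.

(** * Estimates of the constants *)

(** Here [D] is [sqrt d]. Under the lower bound on [r], the radicand is at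
    most [(r / (2 D))^2], so that the factor of [w] is at least
    [2/5 * r / D], while [F <= 5/2 * D^2 * Q]. *)
Lemma width_le (R : rcfType) m (D Q F r w : R) :
  0 < D -> D ^+ 2 = m.+2%:R -> 17 * D ^+ 3 <= r -> 1 <= Q -> Q ^+ 2 <= r ->
  F = 4 * Q + 1 + m%:R -> 0 <= w ->
  w * ((r - 1) / D - Num.sqrt (2 * r + F)) <= F ->
  w * r <= 25 / 4 * D ^+ 3 * Q.
Proof.
move=> D0 DE rD Q1 Qr FE w0 wF.
have m0 : 0 <= m%:R :> R by exact: ler0n.
have mE : m%:R = D ^+ 2 - 2 by rewrite DE -addn2 natrD; ring.
have D2 : 2 <= D ^+ 2 by lra.
have D14 : 7 / 5 <= D by nra.
have D3 : 14 / 5 <= D ^+ 3 by rewrite exprS; nra.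
have FQ : F <= 5 / 2 * D ^+ 2 * Q by rewrite FE mE; nra.
have DDr : 23 * D ^+ 2 <= r by rewrite exprS in rD; nra.
have DQr : D * Q <= r.
  rewrite -(@ler_pXn2r _ 2) ?nnegrE//; [|by nra|by lra].
  by rewrite exprMn; nra.
have radicand : 2 * r + F <= (r / (2 * D)) ^+ 2.
  have -> : (r / (2 * D)) ^+ 2 = r ^+ 2 / (4 * D ^+ 2) by field; rewrite gt_eqF.
  rewrite ler_pdivlMr; last by nra.
  have h1 : 10 * D ^+ 4 * Q <= 10 / 17 * r ^+ 2.
    have -> : 10 * D ^+ 4 * Q = 10 * D ^+ 3 * (D * Q) by ring.
    by nra.
  have h2 : 8 * D ^+ 2 * r <= 8 / 23 * r ^+ 2 by nra.
  have h3 : F * (4 * D ^+ 2) <= 10 * D ^+ 4 * Q.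
    have -> : 10 * D ^+ 4 * Q = 5 / 2 * D ^+ 2 * Q * (4 * D ^+ 2) by field.
    by rewrite ler_wpM2r//; lra.
  by nra.
have sqrt_le : Num.sqrt (2 * r + F) <= r / (2 * D).
  by rewrite -[leRHS]ger0_norm -?sqrtr_sqr ?ler_wsqrtr// divr_ge0//; lra.
have gap : 2 / 5 * r / D <= (r - 1) / D - Num.sqrt (2 * r + F).
  have -> : 2 / 5 * r / D = (r - 1) / D - r / (2 * D) - (r / 10 - 1) / D.
    by field; rewrite gt_eqF.
  have : 0 <= (r / 10 - 1) / D by rewrite divr_ge0//; lra.
  by lra.
have : w * (2 / 5 * r / D) <= 5 / 2 * D ^+ 2 * Q.
  by apply: le_trans FQ; apply: le_trans wF; rewrite ler_wpM2l.
rewrite mulrA ler_pdivrMr//; nra.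
Qed.

(** A form of [r^(-1 + 1/n)] being decreasing in [r], up to a constant factor,
    for [r = Q^n] and [rho = q^n]. The radius [r] may exceed [rho] by any
    amount, whence the case [q < Q]. *)
Lemma root_div_le (R : realFieldType) n (q Q c : R) :
  0 < q -> 0 < Q -> 1 <= c -> q ^+ n.+1 <= c * Q ^+ n.+1 ->
  Q * q ^+ n.+1 <= c * q * Q ^+ n.+1.
Proof.
move=> q0 Q0 c1 qQ; have [Qq|qltQ] := leP Q q.
  rewrite -mulrA mulrCA; apply: ler_pM => //; first exact: ltW.
  by rewrite exprn_ge0// ltW.
have qn : q ^+ n <= Q ^+ n by apply: lerXn2r; rewrite ?nnegrE ltW.
have qQ0 : 0 <= q * Q by rewrite mulr_ge0 ?ltW.
rewrite !exprS; have -> : Q * (q * q ^+ n) = q * Q * q ^+ n by ring.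
have -> : c * q * (Q * Q ^+ n) = c * (q * Q * Q ^+ n) by ring.
apply: (@le_trans _ _ (q * Q * Q ^+ n)); first by rewrite ler_wpM2l.
by rewrite ler_peMl// mulr_ge0// exprn_ge0 ?ltW.
Qed.

Lemma powR_root (R : realType) n (a : R) : 0 <= a -> (0 < n)%N ->
  (a `^ (1 / n%:R)) ^+ n = a.
Proof.
move=> a0 n0; rewrite -powR_mulrn ?powR_ge0// -powRrM mul1r mulVf ?powRr1//.
by rewrite pnatr_eq0 -lt0n.
Qed.

(** Since [N = nu_d^(1/d)] is at least [2 / sqrt d], the root [nu_d^(eps/d)]
    with [eps = 1/2^(d-1)] cannot be small. *)
Lemma half_le_root (R : rcfType) m (N mu : R) :
  0 <= mu -> mu ^+ (2 ^ m.+1) = N -> 1 <= N * (Num.sqrt m.+2%:R / 2) ->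
  1 / 2 <= mu.
Proof.
move=> mu0 muN N1; rewrite leNgt; apply/negP => mu_lt.
have NB : N <= (2 ^+ m.+1)^-1.
  rewrite -muN -exprVn; apply: (@le_trans _ _ (2^-1 ^+ (2 ^ m.+1))).
    by apply: lerXn2r; rewrite ?nnegrE ?invr_ge0//; lra.
  by rewrite ler_iXn2l ?invr_gt0 ?invf_lt1 ?ltr1n// ltnW// ltn_expl.
have D1 : Num.sqrt m.+2%:R < 2 ^+ m.+2 :> R.
  rewrite -(@ltr_pXn2r _ 2) ?nnegrE ?sqrtr_ge0// sqr_sqrtr ?ler0n//.
  rewrite -exprM -natrX ltr_nat; apply: leq_trans (ltn_expl _ (ltnSn 1)) _.
  by rewrite leq_pexp2l// leq_pmulr.
have P0 : 0 < 2 ^+ m.+1 :> R by rewrite exprn_gt0.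
have sqrt0 := sqrtr_ge0 (m.+2%:R : R).
suff : N * (Num.sqrt m.+2%:R / 2) < 1 by lra.
apply: le_lt_trans (_ : (2 ^+ m.+1)^-1 * (Num.sqrt m.+2%:R / 2) < _).
  by rewrite ler_wpM2r// divr_ge0.
rewrite mulrC ltr_pdivrMr// mul1r; rewrite exprS in D1; lra.
Qed.

(** The real exponents are encoded by roots: with [d = m.+2] and
    [eps = 1/2^(d-1)], the variables stand for [D = sqrt d], [N = nu_d^(1/d)],
    [K = k^(1/d)], [mu = N^eps], [kappa = K^eps], [Q = r^eps], and [w] is the
    distance to be bounded. The argument compares [r] with [rho = K / N], the
    radius of a ball of volume [k]; the counting estimate gives
    [rho <= r + D / 2 <= 72/71 * r]. *)
Lemma root_bound_le (R : rcfType) m (D N K mu kappa Q r w : R) :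
  0 < D -> D ^+ 2 = m.+2%:R -> 0 < N -> 0 < K -> 0 < mu -> 0 < kappa ->
  mu ^+ (2 ^ m.+1) = N -> kappa ^+ (2 ^ m.+1) = K ->
  0 <= Q -> Q ^+ (2 ^ m.+1) = r -> 1 / 2 <= mu ->
  N * (18 * D ^+ 3) <= K -> K <= N * (r + D / 2) -> 0 <= w ->
  (1 <= Q -> 1 <= r ->
   w * ((r - 1) / D - Num.sqrt (2 * r + (4 * Q + 1 + m%:R)))
     <= 4 * Q + 1 + m%:R) ->
  w <= 18 * D ^+ 3 * N * (kappa / K).
Proof.
move=> D0 DE N0 K0 mu0 kappa0 muE kappaE Q0 QE mu_ge NcK KNr w0 wQ.
set n := (2 ^ m.+1)%N in muE kappaE QE.
have n0 : (0 < n)%N by rewrite expn_gt0.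
have [q [q0 qE kappaq]] : exists q, [/\ 0 < q, q ^+ n = K / N & kappa = q * mu].
  exists (kappa / mu); rewrite divr_gt0// divfK ?gt_eqF//; split=> //.
  by rewrite expr_div_n kappaE muE.
have [rho [rho0 rhoE crho rhor]] : exists rho,
    [/\ 0 < rho, K = rho * N, 18 * D ^+ 3 <= rho & rho <= r + D / 2].
  exists (K / N); rewrite divr_gt0// divfK ?gt_eqF//; split=> //.
    by rewrite ler_pdivlMr// mulrC.
  by rewrite ler_pdivrMr// mulrC.
have {}qE : q ^+ n = rho by rewrite qE rhoE mulfK ?gt_eqF.
have -> : 18 * D ^+ 3 * N * (kappa / K) = 18 * D ^+ 3 * mu * q / rho.
  by rewrite kappaq rhoE; field; rewrite !gt_eqF.
clear kappaq rhoE NcK KNr kappaE muE kappa0.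
have D2 : 2 <= D ^+ 2 by rewrite DE ler_nat.
have DD3 : 2 * D <= D ^+ 3 by rewrite exprS mulrC ler_wpM2l// ltW.
have D1 : 1 <= D by nra.
have r17 : 17 * D ^+ 3 <= r by lra.
have r1 : 1 <= r by lra.
have Q1 : 1 <= Q by rewrite -(expr_ge1 n0)// QE.
have Q2 : Q ^+ 2 <= r.
  by rewrite -QE ler_weXn2l// /n expnS leq_pmulr// expn_gt0.
have wr : w * r <= 25 / 4 * D ^+ 3 * Q.
  exact: (width_le D0 DE r17 Q1 Q2 erefl w0 (wQ Q1 r1)).
have Qrho : Q * rho <= 72 / 71 * q * r.
  rewrite -QE -qE -(prednK n0); apply: root_div_le => //; [lra|lra|].
  by rewrite prednK// qE QE; lra.
rewrite ler_pdivlMr// -(@ler_pM2r _ r); last by lra.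
have h1 : w * rho * r <= 25 / 4 * D ^+ 3 * (Q * rho).
  by rewrite mulrAC [leRHS]mulrA ler_wpM2r// ltW.
have h2 : 25 / 4 * D ^+ 3 * (Q * rho) <= 25 / 4 * D ^+ 3 * (72 / 71 * q * r).
  by rewrite ler_wpM2l//; lra.
apply: le_trans h1 (le_trans h2 _).
have dqr : 0 <= D ^+ 3 * q * r by rewrite !mulr_ge0 ?ltW//; lra.
have -> : 25 / 4 * D ^+ 3 * (72 / 71 * q * r) =
    450 / 71 * (D ^+ 3 * q * r) by field.
have -> : 18 * D ^+ 3 * mu * q * r = 18 * mu * (D ^+ 3 * q * r) by ring.
by rewrite ler_wpM2r//; lra.
Qed.

(** * Diameter of the chambers *)

Lemma same_side_ge0 (R : realDomainType) (p s t : R) :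
  p != 0 -> 0 <= p * s -> 0 <= p * t -> 0 < s -> 0 <= t.
Proof.
move=> p0 ps pt s0; move: ps; rewrite pmulr_lge0// => p_ge0.
by move: pt; rewrite pmulr_rge0// lt_neqAle eq_sym p0.
Qed.

Lemma brillouin_chamber_dist_le (R : realType) m k (C : set 'rV[R]_m.+2) x y :
  unit_ball_volume R m.+2 * (18 * m.+2%:R * Num.sqrt m.+2%:R) ^+ m.+2 <= k%:R ->
  is_brillouin_chamber k C -> C x -> C y ->
  enorm (x - y) <= 18 * m.+2%:R * Num.sqrt m.+2%:R
    * unit_ball_volume R m.+2 `^ (1 / m.+2%:R)
    * k%:R `^ ((- 1 + 1 / 2 ^+ m.+1) / m.+2%:R).
Proof.
set c := 18 * _ * _; move=> ck [chC Czone] Cx Cy.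
set nu := unit_ball_volume R m.+2 in ck *.
set D : R := Num.sqrt m.+2%:R.
have D0 : 0 < D by rewrite sqrtr_gt0.
have DE : D ^+ 2 = m.+2%:R by rewrite sqr_sqrtr.
have cE : c = 18 * D ^+ 3 by rewrite /c -/D -DE; ring.
have c0 : 0 < c by rewrite cE mulr_gt0// exprn_gt0.
have nu1 : 1 <= nu * (D / 2) ^+ m.+2 by exact: unit_ball_volume_ge.
have nu0 : 0 < nu.
  by rewrite -(@pmulr_lgt0 _ ((D / 2) ^+ m.+2)) ?exprn_gt0 ?divr_gt0//; lra.
have k0 : (0 < k)%N.
  by rewrite -(ltr_nat R); apply: lt_le_trans ck; rewrite mulr_gt0// exprn_gt0.
have [x0 Cx0 sides] := chamber_one_side chC.
(* The midpoint makes [z.v >= 0] available for one of the two directions. *)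
pose z := 2^-1 *: (x + y); pose v := 2^-1 *: (x - y).
have zvx : z + v = x by apply/rowP => i; rewrite !mxE; field.
have zvy : z - v = y by apply/rowP => i; rewrite !mxE; field.
have enormN (u : 'rV[R]_m.+2) : enorm (- u) = enorm u.
  by rewrite /enorm; under eq_bigr do rewrite mxE sqrrN.
have vE : enorm v = enorm (x - y) / 2.
  rewrite /enorm; under eq_bigr do rewrite mxE exprMn.
  rewrite -mulr_sumr sqrtrM ?sqr_ge0// sqrtr_sqr ger0_norm ?invr_ge0//.
  by rewrite mulrC.
have zsides a : a != 0 -> 0 <= bisector_form a x0 * bisector_form a z.
  move=> a0; have [_ fa] := sides a a0; have := fa x Cx; have := fa y Cy.
  rewrite -zvx -zvy !bisector_formD.
  have -> : \sum_i (a ord0 i)%:~R * (- v) ord0 i =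
      - \sum_i (a ord0 i)%:~R * v ord0 i.
    by rewrite -sumrN; apply: eq_bigr => i _; rewrite mxE mulrN.
  lra.
(* The points [b] on the near side at [x0] are weakly on the near side
   at [z]. *)
set r := enorm z.
have kr : k%:R <= nu * (r + D / 2) ^+ m.+2.
  apply: zone_count_le => //; have [_ zone0] := Czone x0 Cx0.
  apply: card_le_trans zone0 _; apply: subset_card_le => b /= [b0].
  rewrite -!bisector_form_le0 => fb; split=> //.
  have [fb0 _] := sides b b0; have := zsides b b0.
  have : bisector_form b x0 < 0 by rewrite lt_neqAle fb0.
  by nra.
pose n := (2 ^ m.+1)%N.
have n0 : (0 < n)%N by rewrite expn_gt0.
pose N := nu `^ (1 / m.+2%:R); pose K : R := k%:R `^ (1 / m.+2%:R).
pose mu := N `^ (1 / n%:R); pose kappa := K `^ (1 / n%:R).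
pose Q := r `^ (1 / n%:R).
have NE : N ^+ m.+2 = nu by rewrite powR_root// ltW.
have KE : K ^+ m.+2 = k%:R by rewrite powR_root.
have N0 : 0 < N by rewrite powR_gt0.
have K0 : 0 < K by rewrite powR_gt0// ltr0n.
have muE : mu ^+ n = N by rewrite powR_root// ltW.
have kappaE : kappa ^+ n = K by rewrite powR_root// ltW.
have r0 : 0 <= r by exact: enorm_ge0.
have QE : Q ^+ n = r by rewrite powR_root.
have mu0 : 0 < mu by rewrite powR_gt0.
have kappa0 : 0 < kappa by rewrite powR_gt0.
have boundE : k%:R `^ ((- 1 + 1 / 2 ^+ m.+1) / m.+2%:R) = kappa / K.
  rewrite mulrC -[X in X * _]mul1r powRrM -/K powRD; last first.
    by apply/implyP => _; rewrite gt_eqF.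
  by rewrite powR_inv1 ?ltW// -natrX -/kappa mulrC.
rewrite boundE -/N.
have rootW (a b : R) : 0 <= a -> 0 <= b -> a ^+ m.+2 <= b ^+ m.+2 -> a <= b.
  by move=> a0 b0; rewrite ler_pXn2r.
have NcK : N * c <= K.
  apply: rootW; [by rewrite mulr_ge0 ?ltW|exact: ltW|].
  by rewrite exprMn NE KE.
have rD0 : 0 <= r + D / 2 by rewrite addr_ge0// divr_ge0// ltW.
have KNr : K <= N * (r + D / 2).
  apply: rootW; first exact: ltW.
    by rewrite mulr_ge0// ltW.
  by rewrite exprMn NE KE.
have mu_ge : 1 / 2 <= mu.
  apply: (half_le_root (ltW mu0) muE).
  have ND0 : 0 <= N * (D / 2) by rewrite mulr_ge0 ?divr_ge0 ?ltW.
  by rewrite -(expr_ge1 (ltn0Sn m.+1))// exprMn NE.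
rewrite cE.
apply: (root_bound_le D0 DE N0 K0 mu0 kappa0 muE kappaE _ QE mu_ge _ KNr).
- exact: powR_ge0.
- by rewrite -cE.
- exact: enorm_ge0.
move=> Q1 r1; have -> : enorm (x - y) = 2 * enorm v by rewrite vE mulrC divfK.
have [zv|zv] := leP 0 (\sum_i z ord0 i * v ord0 i).
  apply: (same_side_dist_le erefl Q1 r1 _ zv); first by rewrite QE.
  move=> a a0 fz; have [fa0 fa] := sides a a0; rewrite zvx.
  exact: same_side_ge0 fa0 (zsides a a0) (fa x Cx) fz.
rewrite -[enorm v]enormN.
apply: (same_side_dist_le erefl Q1 r1); first by rewrite QE.
  under eq_bigr do rewrite [(- v) _ _]mxE mulrN.
  by rewrite sumrN oppr_ge0 ltW.
move=> a a0 fz; have [fa0 fa] := sides a a0; rewrite zvy.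
exact: same_side_ge0 fa0 (zsides a a0) (fa y Cy) fz.
Qed.

Theorem theorem6p3 (R : realType) (d : nat) (d_ge2 : (2 <= d)%N) :
  (exists M : R, \forall k \near \oo,
     forall C : set 'rV[R]_d, is_brillouin_chamber k C ->
       (ediam C <=
        (M * k%:R `^ ((- 1 + 1 / 2 ^+ (d - 1)) / d%:R))%:E)%E) /\
  (forall k : nat,
     unit_ball_volume R d * (18 * d%:R * Num.sqrt d%:R) ^+ d <= k%:R ->
     forall C : set 'rV[R]_d, is_brillouin_chamber k C ->
       (ediam C <=
        (18 * d%:R * Num.sqrt d%:R * unit_ball_volume R d `^ (1 / d%:R)
         * k%:R `^ ((- 1 + 1 / 2 ^+ (d - 1)) / d%:R))%:E)%E).
Proof.
case: d d_ge2 => [|[|m]]// _; rewrite subn1.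
have explicit k (C : set 'rV[R]_m.+2) : unit_ball_volume R m.+2 *
    (18 * m.+2%:R * Num.sqrt m.+2%:R) ^+ m.+2 <= k%:R ->
    is_brillouin_chamber k C ->
    (ediam C <= (18 * m.+2%:R * Num.sqrt m.+2%:R *
      unit_ball_volume R m.+2 `^ (1 / m.+2%:R) *
      k%:R `^ ((- 1 + 1 / 2 ^+ m.+1) / m.+2%:R))%:E)%E.
  move=> ck chC; apply: ge_ereal_sup => _ [[x y] [Cx Cy] <-].
  by rewrite lee_fin; exact: (brillouin_chamber_dist_le ck chC Cx Cy).
split=> [|k ck C]; last exact: explicit.
exists (18 * m.+2%:R * Num.sqrt m.+2%:R *
  unit_ball_volume R m.+2 `^ (1 / m.+2%:R)).
near=> k => C; apply: explicit; near: k; exact: nbhs_infty_ger.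
Unshelve. all: by end_near. Qed.
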